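(* Let $\sigma,\tau,\bar\sigma,\bar\tau$ satisfy the Standing Hypothesis and let $a\ge2$, $n\ge2$ be integers. Then $$\begin{aligned} &\{\sigma,a^n,\tau\,|\,\bar\sigma,1^{n-1},\bar\tau\}-\{\sigma,a+1,a^{n-2},a-1,\tau\,|\,\bar\sigma,1^{n-1},\bar\tau\}\\ &=\sum_{k=1}^{\lfloor n/2\rfloor}\{\sigma,ka,ka,a^{n-2k},\tau\,|\,\bar\sigma,ka,1^{n-2k},\bar\tau\}\\ &\quad+\sum_{k=1}^{\lfloor (n-1)/2\rfloor}\{\sigma,a+1,a^{n-2k-1},ka,ka-1+\tau_1,\tau\backslash\tau_1\,|\,\bar\sigma,1^{n-2k},ka,\bar\tau\backslash\bar\tau_1\}\\ &\quad+\sum_{k=1}^{\lfloor (n-1)/2\rfloor}\{\sigma,ka+1,(k+1)a-1,a^{n-2k-1},\tau\,|\,\bar\sigma,ka+1,1^{n-2k-1},\bar\tau\}\\ &\quad+\sum_{k=1}^{\lfloor (n-2)/2\rfloor}\{\sigma,a+1,a^{n-2k-2},(k+1)a-1,ka+\tau_1,\tau\backslash\tau_1\,|\,\bar\sigma,1^{n-2k-1},ka+1,\bar\tau\backslash\bar\tau_1\}\\ &\quad+\begin{cases}\{\sigma,\tfrac{n+1}{2}a,\tfrac{n-1}{2}a+\tau_1,\tau\backslash\tau_1\,|\,\bar\sigma,\tfrac{n-1}{2}a+1,\bar\tau\backslash\bar\tau_1\}&\text{if $n$ is odd},\\[1mm] \{\sigma,\tfrac n2a+1,\tfrac n2a-1+\tau_1,\tau\backslash\tau_1\,|\,\bar\sigma,\tfrac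 n2a,\bar\tau\backslash\bar\tau_1\}&\text{if $n$ is even}.\end{cases} \end{aligned}$$ If $s=0$, $\sigma$ and $\bar\sigma$ are omitted from every expression. If $t=0$, the terms in the second, fourth and final (case-defined) lines of the right-hand side (all terms containing $\tau\backslash\tau_1$) are omitted, and $\tau,\bar\tau$ are omitted from the remaining terms. If $t=1$, $\tau\backslash\tau_1$ and $\bar\tau\backslash\bar\tau_1$ are empty. The right-hand side has $2n-2$ terms when $t>0$ and $n-1$ terms when $t=0$.
   Context: Overlap notation: for $\alpha=(\alpha_1,\dots,\alpha_L)$ with $\alpha_i\ge1$ and $\beta=(\beta_1,\dots,\beta_{L-1})$ with $0\le\beta_i\le\min\{\alpha_i,\alpha_{i+1}\}$, $(\alpha\,|\,\beta)$ is the skew diagram $\lambda/\mu$ (boxes $(i,j)$ with $\mu_i<j\le\lambda_i$, identified up to deleting empty rows/columns) with $L$ nonempty rows, $\lambda_i-\mu_i=\alpha_i$, $\lambda_{i+1}-\mu_i=\beta_i$ (row $i$ has $\alpha_i$ boxes, rows $i,i+1$ share $\beta_i$ columns); $\{\alpha\,|\,\beta\}=s_{\lambda/\mu}$ is its skew Schur function (generating function of semistandard Young tableaux of that shape). Commas denote concatenation of sequences; $a^j$ denotes $j$ copies of $a$ (empty if $j=0$). Standing Hypothesis: $\sigma=(\sigma_1,\dots,\sigma_s)$, $\tau=(\tau_1,\dots,\tau_t)$ compositions, $s,t\ge0$; $\bar\sigma,\bar\tau$ sequences of non-negative integers of lengths $s,t$; $\bar\sigma_s=1$ if $s>0$; $\bar\tau_1=1$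 if $t>0$; $\bar\sigma_i\le\min\{\sigma_i,\sigma_{i+1}\}$ ($1\le i<s$), $\bar\tau_i\le\min\{\tau_i,\tau_{i-1}\}$ ($1<i\le t$). $\tau\backslash\tau_1$ removes the first part of $\tau$ and $\bar\tau\backslash\bar\tau_1$ the first entry of $\bar\tau$. *)

(* Defs.v *)
From HB Require Import structures.
From mathcomp Require Import all_boot all_order all_algebra.
Set Implicit Arguments. Unset Strict Implicit. Unset Printing Implicit Defensive.

(* Overlap notation (alpha | beta): rows indexed 0..L-1 from the top (English
   notation).  [rows alpha beta] lists, for each row i, the pair (mu_i, lambda_i)
   so that row i consists of the columns j with mu_i <= j < lambda_i (0-based).
   It is computed bottom-up with mu_{L-1} = 0 and
     lambda_{i+1} - mu_i = beta_i,  lambda_i - mu_i = alpha_i. *)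
Fixpoint rows (alpha beta : seq nat) : seq (nat * nat) :=
  match alpha with
  | [::] => [::]
  | a :: al =>
      match al with
      | [::] => [:: (0, a)]
      | _ :: _ =>
          let rest := rows al (behead beta) in
          let mu := (head (0, 0) rest).2 - head 0 beta in
          (mu, mu + a) :: rest
      end
  end.

Definition cells (alpha beta : seq nat) : seq (nat * nat) :=
  let r := rows alpha beta in
  flatten [seq [seq (i, j) | j <- iota (nth (0, 0) r i).1
                                        ((nth (0, 0) r i).2 - (nth (0, 0) r i).1)]
          | i <- iota 0 (size r)].

Definition is_ssyt (cs : seq (nat * nat)) (N : nat)
    (f : {ffun 'I_(size cs) -> 'I_N}) : bool :=
  [forall k : 'I_(size cs), forall l : 'I_(size cs),
     let p := nth (0, 0) cs k in let q := nth (0, 0) cs l in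
     [&& ((p.1 == q.1) && (p.2 < q.2)) ==> (f k <= f l)
       & ((p.2 == q.2) && (p.1 < q.1)) ==> (f k < f l)]].

(* Content: the value i (standing for the variable x_{i+1}) occurs c_i times. *)
Definition has_content (cs : seq (nat * nat)) (c : seq nat)
    (f : {ffun 'I_(size cs) -> 'I_(size c)}) : bool :=
  [forall i : 'I_(size c), #|[pred k | f k == i]| == nth 0 c i].

(* skew_coef alpha beta c = coefficient of the monomial
   x_1^{c_1} ... x_m^{c_m} (m = size c) in the skew Schur function
   {alpha | beta} = s_{lambda/mu}, i.e. the number of SSYT of shape
   (alpha | beta) with content c.  Two symmetric functions are equal iff
   all these coefficients agree. *)
Definition skew_coef (alpha beta : seq nat) (c : seq nat) : nat :=
  let cs := cells alpha beta in
  #|[pred f : {ffun 'I_(size cs) -> 'I_(size c)} |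
      is_ssyt f && has_content f]|.

(* Main.v *)
(** Let [h m] be the one-row function, and for a sequence [w] of rows glued with
overlaps 1 let [L w], [R w], [B w] be the functions of [w] attached to sigma, to
tau, and to both.  A two-row Lindstroem-Gessel-Viennot tail swap gives
[{U,p}{q,D} = {U,p,q,D | o} + h_{o-1} {U,p+q-o+1,D}].  Taking for [o] the overlap
displayed in each term on the right-hand side, the first and third families
become [L(x) R(y,a^j) - h_{x-1} B(y+1,a^j)], and the terms containing the merged
row of tau become [h_{x-1} B(a+1,a^{j-1},y) - L(a+1,a^{j-1},y) R(x-1)], which
vanishes when tau is empty.  Here [i = n - j] runs over [2..n] and [(x,y)] is
[(ka,ka)] or [(ka+1,(k+1)a-1)] according to the parity of [i].  For [i = 1], with
[L] and [R] of the empty row read as 0, the same expression is minus the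
left-hand side, so the theorem says that the sum over [1..n] vanishes.  Taking
[o = 1] expands everything in the commuting variables [L(p)], [R(q)], [h_m]; the
sum then telescopes in [j] down to convolutions that cancel because the
generating functions of the ribbons [(a^j)] are quotients by [sum_k h_{ka} t^k]. *)
Require Import Defs.
From HB Require Import structures.
From mathcomp Require Import all_boot all_order all_algebra.
From mathcomp Require Import zify ring mpoly.
Set Implicit Arguments. Unset Strict Implicit. Unset Printing Implicit Defensive.
Import GRing.Theory.

(** * Cancellation of the telescoped sum *)

Section Convolution.
Local Open Scope ring_scope.
Variable R : comNzRingType.
Implicit Types f g k : nat -> R.

Definition conv f g n : R := \sum_(i < n.+1) f i * g (n - i)%N.

Lemma eq_conv f f' g g' n : (forall i, (i <= n)%N -> f i = f' i) ->
  (forall i, (i <= n)%N -> g i = g' i) -> conv f g n = conv f' g' n.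
Proof.
move=> ef eg; apply: eq_bigr => i _.
by rewrite ef ?eg ?leq_subr // -ltnS.
Qed.

(** Truncation to polynomials turns convolution into a product, so commutativity and associativity
    come from [{poly R}]. *)
Lemma coef_conv f g n i : (i <= n)%N ->
  (\poly_(j < n.+1) f j * \poly_(j < n.+1) g j)`_i = conv f g i.
Proof.
move=> le_in; rewrite coefM; apply: eq_bigr => j _; rewrite !coef_poly.
have := ltn_ord j; rewrite ltnS => le_ji.
by rewrite !ifT // ltnS; lia.
Qed.

Lemma convC f g n : conv f g n = conv g f n.
Proof. by rewrite -!(coef_conv _ _ (leqnn n)) mulrC. Qed.

Lemma convA f g k n : conv f (conv g k) n = conv (conv f g) k n.
Proof.
pose p f := \poly_(j < n.+1) f j.
have E f' (p' : {poly R}) : (forall i, (i <= n)%N -> p'`_i = f' i) ->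
  forall g', conv g' f' n = (p g' * p')`_n.
  move=> e g'; rewrite coefM; apply: eq_bigr => i _.
  by rewrite coef_poly ltn_ord e ?leq_subr.
rewrite (E _ (p g * p k)); last by move=> i; apply: coef_conv.
rewrite convC (E _ (p f * p g)); last by move=> i; apply: coef_conv.
by congr (_`_n); rewrite mulrA mulrC.
Qed.

Lemma convCA f g k n : conv f (conv g k) n = conv g (conv f k) n.
Proof. by rewrite !convA; apply: eq_conv => // i _; apply: convC. Qed.

Lemma convNr f g n : conv f (fun i => - g i) n = - conv f g n.
Proof. by rewrite /conv -sumrN; apply: eq_bigr => i _; rewrite mulrN. Qed.

Lemma convBr f g k n :
  conv f (fun i => g i - k i) n = conv f g n - conv f k n.
Proof. by rewrite /conv -sumrB; apply: eq_bigr => i _; rewrite mulrBr. Qed.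

End Convolution.

(** * Ribbon recurrences and the vanishing of the sum of blocks *)

Section Recurrence.
Local Open Scope ring_scope.
Variables (R : comNzRingType) (a : nat) (h l r : nat -> R).
Hypotheses (a_gt0 : (0 < a)%N) (h0 : h 0 = 1) (l0 : l 0 = 0) (r0 : r 0 = 0).

(* With [f] recording the one-row values, [peel f j m] is the value of the ribbon
   with rows [m], [a^j], obtained by cutting off the free end [m]. *)
Fixpoint peel (f : nat -> R) j m : R :=
  if j is j'.+1 then peel f j' a * h m - peel f j' (m + a)%N else f m.

(* The value of [B(a+1,a^{j-1},y) - B(y+1,a^j)], by cutting both ribbons. *)
Fixpoint peel2 j y : R :=
  if j is j'.+1 then peel l j' a * r y - l y * peel r j' a - peel2 j' (y + a)%N
  else 0.

(* [mu (2k) = ka - 1] and [mu (2k+1) = ka]; with the header's notation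
   [mu i = x - 1] and [i a - 1 - mu i = y]. *)
Definition mu i : nat := (i./2 * a - ~~ odd i)%N.

(** The right-hand terms of one index, added: with [m = x - 1], [l m] stands for the header's [L(x)]
    and [r m] for [R(x-1)]; the two multiples of [h m] combine into [peel2]. *)
Definition block j m y : R :=
  l m * peel r j y - peel l j y * r m + h m * peel2 j y.

Let mult0 f k : R := f (k * a)%N.
(** The value at 0 stands for the row length -1; truncated subtraction would return [f 0], which is
    1 for [h]. *)
Let mult1 f k : R := if k is _.+1 then f (k * a).-1 else 0.

Lemma mu_even k : mu k.*2 = (k * a).-1.
Proof. by rewrite /mu odd_double doubleK subn1. Qed.

Lemma mu_odd k : mu k.*2.+1 = (k * a)%N.
Proof. by rewrite /mu /= odd_double uphalf_double subn0. Qed.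

(** Of the two indices only the even one contributes -1. The range keeps both away from index 0,
    where truncation gives 0 instead of -1. *)
Lemma mu_compl I i : (0 < i <= I.*2)%N -> ((I * a).-1 - mu i)%N = mu (I.*2.+1 - i).
Proof.
move=> /andP[i0 iI]; rewrite -(odd_double_half i) in i0 iI *.
case: (odd i) i0 iI; rewrite ?add1n ?add0n => i0 iI.
  have -> : (I.*2.+1 - i./2.*2.+1 = (I - i./2).*2)%N by lia.
  rewrite mu_odd mu_even mulnBl; lia.
have -> : (I.*2.+1 - i./2.*2 = (I - i./2).*2.+1)%N by lia.
have : (0 < i./2 * a)%N by rewrite muln_gt0 a_gt0; lia.
have : (i./2 * a <= I * a)%N by rewrite leq_mul2r; lia.
rewrite mu_odd mu_even mulnBl; lia.
Qed.

Lemma sum_even_odd (F : nat -> R) I :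
  \sum_(1 <= i < I.*2.+1) F i = \sum_(i < I) (F i.*2.+1 + F i.*2.+2).
Proof.
elim: I => [|I IH]; first by rewrite big_geq // big_ord0.
by rewrite big_ord_recr doubleS /= 2?big_nat_recr //= IH addrA.
Qed.

(* [mu_compl] pairs index [i] with [2I + 1 - i] of opposite parity, so the
   antisymmetric sum over [1..I] unfolds to a sum over [1..2I]. *)
Lemma fold_alternating (f g : nat -> R) I :
  \sum_(1 <= i < I.+1) (-1) ^+ i *
    (f (mu i) * g ((I * a).-1 - mu i)%N - g (mu i) * f ((I * a).-1 - mu i)%N)
  = conv (mult1 f) (mult0 g) I - conv (mult0 f) (mult1 g) I.
Proof.
pose F i := (-1) ^+ i * (f (mu i) * g (mu (I.*2.+1 - i))).
transitivity (\sum_(1 <= i < I.*2.+1) F i).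
  rewrite [RHS](@big_cat_nat _ _ _ I.+1) //=; last by lia.
  have -> : \sum_(I.+1 <= i < I.*2.+1) F i = \sum_(1 <= i < I.+1) F (I.*2.+1 - i)%N.
    rewrite big_nat_rev /= -[X in bigop.index_iota X]add1n big_addn.
    have -> : (I.*2.+1 - I = I.+1)%N by lia.
    by apply: eq_big_nat => i /andP[i0 iI]; congr (F _); lia.
  rewrite -big_split; apply: eq_big_nat => i /andP[i0 iI] /=.
  rewrite (@mu_compl I) ?i0; last by lia.
  rewrite /F.
  have -> : (I.*2.+1 - (I.*2.+1 - i) = i)%N by lia.
  rewrite -[(-1) ^+ (_ - _)]signr_odd oddB; last by lia.
  rewrite /= odd_double /= -[(-1) ^+ i]signr_odd.
  by case: (odd i); rewrite /= ?expr0 ?expr1; ring.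
(* The first summand of one convolution and the last of the other contain [mult1 _ 0 = 0]. Of the
   rest, even indices give the first convolution and odd ones the second. *)
rewrite sum_even_odd /conv big_ord_recl big_ord_recr /= mul0r add0r.
rewrite subnn mulr0 addr0 -sumrB; apply: eq_bigr => i _.
rewrite /F /bump add1n.
have -> : (I.*2.+1 - i.*2.+1 = (I - i).*2)%N by have := ltn_ord i; lia.
have -> : (I.*2.+1 - i.*2.+2 = (I - i.+1).*2.+1)%N by have := ltn_ord i; lia.
rewrite -doubleS !mu_odd !mu_even /mult0 /=.
rewrite -[(-1) ^+ _.+1]signr_odd -[(-1) ^+ _.*2]signr_odd /= odd_double /= expr0 expr1.
have : (0 < I - i)%N by rewrite subn_gt0.
by case: (I - i)%N => // d _; rewrite /mult1; ring.
Qed.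

(** What is left of two consecutive blocks once the recurrences cancel everything at [y + a]. It is
    antisymmetric in [m] and [y], as [fold_alternating] requires. *)
Definition defect j m y : R :=
  peel r j a * (l m * h y - h m * l y) - peel l j a * (r m * h y - h m * r y).

Lemma block_step j m y :
  block j.+1 m y + block j m (y + a)%N = defect j m y.
Proof. rewrite /block /defect /=; ring. Qed.

(** The signed value of the ribbon with [j] rows in all; there is none for [j = 0]. *)
Definition signed f j : R := if j is j'.+1 then (-1) ^+ j * peel f j' a else 0.

(** The ribbon series is a quotient by [sum_k h(ka) t^k]: unroll the recurrence down to one row and
    set the free end to 0, where the ribbon vanishes because [h 0 = 1]. *)
Lemma peel_conv f n : f 0 = 0 -> conv (signed f) (mult0 h) n = - mult0 f n.
Proof.
move=> f0.
have E j m : peel f j m = \sum_(i < j) (-1) ^+ i * h (m + i * a)%N * peel f (j - i.+1) a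
      + (-1) ^+ j * f (m + j * a)%N.
  elim: j m => [|j IH] m; first by rewrite big_ord0 add0r mul1r mul0n addn0.
  rewrite big_ord_recl /= [peel f j (m + a)%N]IH expr0 mul1r mul0n addn0 subn1 /= mulrC -addrA; congr (_ + _).
  rewrite opprD -sumrN exprS mulN1r mulNr mulSn addnA; congr (_ - _).
  apply: eq_bigr => i _; rewrite /bump add1n exprS mulN1r mulSn addnA.
  by rewrite !mulNr subSS.
have P0 j : peel f j 0 = 0.
  by elim: j => [|j IH] //=; rewrite h0 mulr1 add0n subrr.
case: n => [|n]; first by rewrite /conv big_ord_recl big_ord0 /= mul0r add0r /mult0 mul0n f0 oppr0.
have := E n.+1 0%N; rewrite P0 add0n => /esym/eqP; rewrite addrC addr_eq0 => /eqP e.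
rewrite /conv big_ord_recl /= mul0r add0r /mult0.
have -> : - f (n.+1 * a)%N = - ((-1) ^+ n.+1 * ((-1) ^+ n.+1 * f (n.+1 * a)%N)).
  by rewrite mulrA -expr2 sqrr_sign mul1r.
rewrite e mulrN opprK big_distrr /= (reindex_inj rev_ord_inj) /=.
apply: eq_bigr => i _; have iI := ltn_ord i.
rewrite /bump add1n add0n.
have -> : (n.+1 - (n.+1 - i.+1).+1 = i)%N by lia.
have -> : (n.+1 - i.+1 = n - i)%N by lia.
have e2 : (-1) ^+ n.+1 = (-1) ^+ (n.+1 - i) * (-1) ^+ i :> R.
  by rewrite -exprD subnK // ltnW.
rewrite e2 -subSn //.
have := sqrr_sign R i; rewrite expr2 => es.
ring: es.
Qed.

Theorem block_sum n :
  \sum_(1 <= i < n.+1) block (n - i) (mu i) ((i * a).-1 - mu i) = 0.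
Proof.
(* Along [I + j = n], neighbouring values of [V] add up to a defect sum plus one signed summand of
   the target, so a telescoping from [V 0 n = 0] to [V n 0] recovers the target. *)
pose V I j := \sum_(1 <= i < I.+1) (-1) ^+ i * block j (mu i) ((I * a).-1 - mu i).
pose Q I j := \sum_(1 <= i < I.+1) (-1) ^+ i * defect j (mu i) ((I * a).-1 - mu i).
have Vstep I j : V I j.+1 + V I.+1 j =
    Q I j + (-1) ^+ I.+1 * block j (mu I.+1) ((I.+1 * a).-1 - mu I.+1).
  rewrite /V [X in _ + X]big_nat_recr //= addrA; congr (_ + _).
  rewrite -big_split; apply: eq_big_nat => i /andP[i0 iI] /=.
  rewrite -block_step [RHS]mulrDr; congr (_ + _ * block _ _ _).
  (* Truncated subtraction gains exactly [a] from [I] to [I + 1] because [mu i <= I * a - 1]. *)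
  have : (0 < I * a)%N by rewrite muln_gt0 a_gt0; lia.
  have : ((I * a).-1 - mu i = mu (I.*2.+1 - i))%N by apply: mu_compl; lia.
  have : (mu i <= (I * a).-1)%N; last by lia.
  rewrite /mu; have : (i./2 * a <= I * a)%N by rewrite leq_mul2r; lia.
  case: (boolP (odd i)) => oi /=; last by lia.
  have : (i./2.+1 * a <= I * a)%N by rewrite leq_mul2r; lia.
  rewrite mulSn; lia.
have V0 j : V 0 j = 0 by rewrite /V big_geq.
have Qe I j : Q I j = peel r j a * (conv (mult1 l) (mult0 h) I - conv (mult0 l) (mult1 h) I)
    - peel l j a * (conv (mult1 r) (mult0 h) I - conv (mult0 r) (mult1 h) I).
  rewrite -!fold_alternating !big_distrr /= -sumrB; apply: eq_bigr => i _.
  by rewrite /defect; ring.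
have Vn : V n 0 = conv (mult1 l) (mult0 r) n - conv (mult0 l) (mult1 r) n.
  rewrite -fold_alternating; apply: eq_bigr => i _.
  by rewrite /block /= mulr0 addr0 [r _ * _]mulrC.
pose S := \sum_(1 <= i < n.+1) block (n - i) (mu i) ((i * a).-1 - mu i).
have key : V n 0 = (-1) ^+ n * S + \sum_(I < n) (-1) ^+ (n - I.+1) * Q I (n - I.+1)%N.
  have := telescope_sumr (fun I => (-1) ^+ (n - I) * V I (n - I)%N) (leq0n n).
  rewrite subnn mul1r V0 mulr0 subr0 => <-.
  rewrite /S big_add1 big_mkord big_distrr /= -big_split big_mkord.
  apply: eq_bigr => i _; have iI := ltn_ord i.
  have -> : (n - i = (n - i.+1).+1)%N by lia.
  rewrite exprS mulN1r mulNr opprK -mulrDr [V i.+1 _ + _]addrC Vstep mulrDr addrC mulrA.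
  by rewrite -exprD subnK.
(* The shift in [signed] absorbs the sign up to a global -1, and the summand [I = n] vanishes since
   [signed _ 0 = 0]. *)
have eQ : \sum_(I < n) (-1) ^+ (n - I.+1) * Q I (n - I.+1)%N =
    conv (signed l) (fun I => conv (mult1 r) (mult0 h) I - conv (mult0 r) (mult1 h) I) n
    - conv (signed r) (fun I => conv (mult1 l) (mult0 h) I - conv (mult0 l) (mult1 h) I) n.
  rewrite [in RHS]convC [X in _ - X]convC /conv !big_ord_recr /= subnn !mulr0 !addr0 -sumrB.
  apply: eq_bigr => i _; have iI := ltn_ord i.
  have -> : (n - i = (n - i.+1).+1)%N by lia.
  by rewrite Qe /signed /conv exprS; ring.
have sr : conv (signed r) (mult0 h) =1 (fun i => - mult0 r i) by move=> i; apply: peel_conv.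
have sl : conv (signed l) (mult0 h) =1 (fun i => - mult0 l i) by move=> i; apply: peel_conv.
have e1 : conv (signed r) (conv (mult1 l) (mult0 h)) n = - conv (mult1 l) (mult0 r) n.
  by rewrite convCA -convNr; apply: eq_conv => // i _; apply: sr.
have e2 : conv (signed l) (conv (mult1 r) (mult0 h)) n = - conv (mult0 l) (mult1 r) n.
  by rewrite convCA [in RHS]convC -convNr; apply: eq_conv => // i _; apply: sl.
(* Substituting [mult0 l] and [mult0 r] by [peel_conv] turns both sides into minus the convolution
   of [signed l], [signed r], [mult0 h] and [mult1 h]. *)
have e3 : conv (signed r) (conv (mult0 l) (mult1 h)) n = conv (signed l) (conv (mult0 r) (mult1 h)) n.
  apply: oppr_inj; rewrite convCA [in RHS]convCA [in LHS]convC [in RHS]convC -!convNr.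
  transitivity (conv (conv (signed r) (mult1 h)) (conv (signed l) (mult0 h)) n).
    by apply: eq_conv => // i _; rewrite sl.
  transitivity (conv (conv (signed l) (mult1 h)) (conv (signed r) (mult0 h)) n); last first.
    by apply: eq_conv => // i _; rewrite sr.
  rewrite -convA -[RHS]convA.
  transitivity (conv (signed r) (conv (signed l) (conv (mult1 h) (mult0 h))) n).
    by apply: eq_conv => // i _; apply: convCA.
  by rewrite convCA; apply: eq_conv => // i _; apply: convCA.
move: key; rewrite eQ Vn !convBr e1 e2 e3 => /eqP; rewrite -subr_eq0 => /eqP e4.
have sq : (-1) ^+ n * (-1) ^+ n = 1 :> R by rewrite -expr2 sqrr_sign.
rewrite -/S -[S]mul1r -sq -mulrA.
have -> : (-1) ^+ n * S = 0 by apply: oppr_inj; rewrite oppr0 -e4; ring.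
by rewrite mulr0.
Qed.

End Recurrence.

(** * Row fillings and the two-row tail swap *)

Section SeqSums.
Local Open Scope ring_scope.
Variables (R : comNzRingType) (N : nat).
Implicit Types (F G : seq nat -> R) (s u v : seq nat).

(** Words are plain sequences, so cutting and regluing them in the tail swap needs no casts. *)
Fixpoint seqsum p F : R :=
  if p is p'.+1 then \sum_(i < N) seqsum p' (fun s => F (val i :: s)) else F [::].

Lemma eq_seqsum p F G : (forall s, size s = p -> F s = G s) ->
  seqsum p F = seqsum p G.
Proof.
elim: p F G => [|p IH] F G eFG /=; first exact: eFG.
by apply: eq_bigr => i _; apply: IH => s ss; apply: eFG; rewrite /= ss.
Qed.

Lemma seqsum_cat m n F :
  seqsum (m + n) F = seqsum m (fun u => seqsum n (fun v => F (u ++ v))).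
Proof. by elim: m F => [|m IH] F //=; apply: eq_bigr => i _; apply: IH. Qed.

Lemma seqsum_split k p F : (k <= p)%N ->
  seqsum p F = seqsum k (fun u => seqsum (p - k) (fun v => F (u ++ v))).
Proof. by move=> le_kp; rewrite -seqsum_cat subnKC. Qed.

Lemma seqsumD p F G : seqsum p (fun s => F s + G s) = seqsum p F + seqsum p G.
Proof.
by elim: p F G => [|p IH] F G //=; rewrite -big_split; apply: eq_bigr => i _; apply: IH.
Qed.

Lemma seqsumMr p F c : seqsum p (fun s => F s * c) = seqsum p F * c.
Proof.
elim: p F => [|p IH] F //=; rewrite big_distrl.
by apply: eq_bigr => i _; apply: IH.
Qed.

Lemma seqsumMl p F c : seqsum p (fun s => c * F s) = c * seqsum p F.
Proof.
rewrite mulrC -seqsumMr; by apply: eq_seqsum => s _; rewrite mulrC.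
Qed.

Lemma seqsumB p F G : seqsum p (fun s => F s - G s) = seqsum p F - seqsum p G.
Proof.
rewrite seqsumD -[- seqsum p G]mulN1r -seqsumMl; congr (_ + _).
by apply: eq_seqsum => s _; rewrite mulN1r.
Qed.

Lemma seqsum0 p : seqsum p (fun=> 0) = 0.
Proof. by elim: p => //= p IH; apply: big1 => i _; apply: IH. Qed.

Lemma seqsum_sum p n (F : 'I_n -> seq nat -> R) :
  seqsum p (fun s => \sum_(i < n) F i s) = \sum_(i < n) seqsum p (F i).
Proof.
elim: p F => [|p IH] F //=; rewrite exchange_big /=.
by apply: eq_bigr => i _; apply: IH.
Qed.

Lemma exchange_seqsum p q (F : seq nat -> seq nat -> R) :
  seqsum p (fun u => seqsum q (F u)) = seqsum q (fun v => seqsum p (F^~ v)).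
Proof.
elim: p F => [|p IH] F //=; rewrite seqsum_sum.
by apply: eq_bigr => i _; apply: IH.
Qed.

End SeqSums.

Lemma sorted_cat (s t : seq nat) : sorted leq (s ++ t) =
  [&& sorted leq s, sorted leq t & [|| nilp s, nilp t | last 0 s <= head 0 t]].
Proof.
case: s => [|x s] /=; first by rewrite andbT.
case: t => [|y t] /=; first by rewrite cats0 andbT.
by rewrite cat_path /=; bool_congr; rewrite andbC.
Qed.

(* The first [b] entries of the upper row [r] lie above the last [b] entries of
   the lower row [s]. *)
Definition overlap_ok b (r s : seq nat) : bool :=
  all (fun t => nth 0 r t < nth 0 s (size s - b + t)) (iota 0 b).

Section RowSums.
Local Open Scope ring_scope.
Variables (R : comNzRingType) (N : nat) (x : nat -> R).
Implicit Types (g d : seq nat -> R) (r s u v w : seq nat).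

Definition wt s : R := \prod_(i <- s) x i.

Lemma wt_cat u v : wt (u ++ v) = wt u * wt v.
Proof. exact: big_cat. Qed.

Local Notation T := (@seqsum R N).

Section TwoRows.
Variables (g d : seq nat -> R) (p q o : nat).
Hypotheses (o_gt0 : (0 < o)%N) (le_op : (o <= p)%N) (le_oq : (o <= q)%N).
(** [g] and [d] carry the coupling to the rows above and below. They see only the last [p - o + 1]
    and the first [q - o + 1] entries, which every swap keeps together. *)
Hypothesis g_suffix : forall u u' t, (p < size t + o)%N -> g (u ++ t) = g (u' ++ t).
Hypothesis d_prefix : forall s t t', (q < size s + o)%N -> d (s ++ t) = d (s ++ t').

Let ok i r s := all (fun t => nth 0%N r t < nth 0%N s (q - o + t))%N (iota 0 i).
(** The short row has only [o.-1] entries, so column [o.-1] always counts as a failure; this makes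
    [B o] zero. *)
Let ok' i w v :=
  all (fun t => (t < o.-1) && (nth 0%N w t < nth 0%N v (q - o + t)))%N (iota 0 i).

Let A i := T p (fun r => T q (fun s =>
  [&& sorted leq r, sorted leq s & ok i r s]%:R * (wt r * wt s * g r * d s))).
Let B i := T o.-1 (fun w => T (p + q - o.-1) (fun v =>
  [&& sorted leq w, sorted leq v & ok' i w v]%:R * (wt w * wt v * g v * d v))).

(* Both sides exchange the tails after the first violation of strictness, at
   column [i] of the overlap. *)
Lemma tail_swap r1 r2 s1 s2 i : (i < o)%N ->
  size r1 = i -> size r2 = (p - i)%N -> size s1 = (q - o + i).+1 ->
  size s2 = (o.-1 - i)%N ->
  [&& sorted leq (r1 ++ r2), sorted leq (s1 ++ s2), ok i (r1 ++ r2) (s1 ++ s2)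
    & (nth 0 (s1 ++ s2) (q - o + i) <= nth 0 (r1 ++ r2) i)%N]
  = [&& sorted leq (r1 ++ s2), sorted leq (s1 ++ r2), ok' i (r1 ++ s2) (s1 ++ r2)
    & ~~ ((i < o.-1)%N && (nth 0 (r1 ++ s2) i < nth 0 (s1 ++ r2) (q - o + i))%N)].
Proof.
move=> lt_io sr1 sr2 ss1 ss2.
have ltq t : (t <= i)%N -> (q - o + t < size s1)%N by rewrite ss1; lia.
have e1 t' : ok i (r1 ++ r2) (s1 ++ t') = ok i r1 s1.
  apply: eq_in_all => t; rewrite mem_iota add0n => /= ti.
  by rewrite !nth_cat sr1 ti ltq // ltnW.
have e2 t' : ok' i (r1 ++ s2) (s1 ++ t') = ok i r1 s1.
  apply: eq_in_all => t; rewrite mem_iota add0n => /= ti.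
  rewrite !nth_cat sr1 ti ltq ?(ltnW ti) //.
  by have -> : (t < o.-1)%N by lia.
rewrite e1 e2 !nth_cat ltq // sr1 ltnn subnn !nth0 !sorted_cat.
have -> : nth 0%N s1 (q - o + i) = last 0%N s1 by rewrite -nth_last ss1.
have -> : nilp r2 = false by rewrite /nilp sr2; lia.
have -> : nilp s1 = false by rewrite /nilp ss1.
have -> : nilp s2 = ~~ (i < o.-1)%N by rewrite /nilp ss2; lia.
rewrite !orFb negb_and -!leqNgt.
case S1: (sorted leq s1); last by rewrite !andbF.
case O1: (ok i r1 s1); last by rewrite !andbF.
(* Column [i - 1] is strict and [s1] is weakly increasing, so any tail that can continue [s1] can
   also continue [r1]. *)
have lr : nilp r1 || (last 0%N r1 < last 0%N s1)%N.
  have [i0|i_gt0] := posnP i; first by rewrite /nilp sr1 i0.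
  have /(allP O1)/= : i.-1 \in iota 0 i by rewrite mem_iota; lia.
  rewrite -[last 0 r1]nth_last sr1 => /leq_trans -> //; first by rewrite orbT.
  rewrite -nth_last ss1.
  by apply: (sorted_leq_nth leq_trans leqnn) => //; rewrite ?inE ?ss1; lia.
have J (t : seq nat) : (last 0 s1 <= head 0 t)%N -> nilp r1 || (last 0 r1 <= head 0 t)%N.
  by move=> h; case: (nilp r1) lr => //= lr; apply: leq_trans h; apply: ltnW.
have [h2|_] := boolP (last 0 s1 <= head 0 r2)%N; last by rewrite !andbF.
have [t2|_] := boolP (last 0 s1 <= head 0 s2)%N; last first.
  case: (o.-1 <= i)%N; last by rewrite !andbF.
  by move: (J _ h2); case: (nilp r1) => /= [_|->]; rewrite !andbT -andbA [X in _ && X]andbC andbA.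
move: (J _ h2) (J _ t2); rewrite !orbT.
by case: (nilp r1) => /= [_ _|-> ->]; rewrite ?orbT !andbT -andbA [X in _ && X]andbC andbA.
Qed.

Lemma seqsum4 (F : seq nat -> seq nat -> seq nat -> seq nat -> R) a b c e :
  T a (fun u => T b (fun v => T c (fun w => T e (F u v w)))) =
  T a (fun u => T e (fun z => T c (fun w => T b (fun v => F u v w z)))).
Proof.
apply: eq_seqsum => u _; rewrite exchange_seqsum [RHS]exchange_seqsum.
by apply: eq_seqsum => w _; rewrite exchange_seqsum.
Qed.

(** Each difference collects the pairs whose first failure is at column [i]; swapping tails there is
    a weight-preserving bijection between the two sets of pairs. *)
Lemma two_row_step i : (i < o)%N -> A i - A i.+1 = B i - B i.+1.
Proof.
move=> lt_io.
pose Phi r s := [&& sorted leq r, sorted leq s, ok i r s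
   & (nth 0 s (q - o + i) <= nth 0 r i)%N]%:R * (wt r * wt s * g r * d s).
pose Psi w v := [&& sorted leq w, sorted leq v, ok' i w v
   & ~~ ((i < o.-1)%N && (nth 0 w i < nth 0 v (q - o + i))%N)]%:R
   * (wt w * wt v * g v * d v).
have indB (b1 b2 b3 Q : bool) :
    [&& b1, b2 & b3]%:R - [&& b1, b2 & b3 && Q]%:R = [&& b1, b2, b3 & ~~ Q]%:R :> R.
  by case: b1; case: b2; case: b3; case: Q; rewrite ?subrr ?subr0.
transitivity (T p (fun r => T q (Phi r))).
  rewrite -seqsumB; apply: eq_seqsum => r _; rewrite -seqsumB; apply: eq_seqsum => s _.
  rewrite -mulrBl /ok -(addn1 i) iotaD all_cat /= andbT indB.
  by rewrite /Phi -leqNgt.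
transitivity (T o.-1 (fun w => T (p + q - o.-1) (Psi w))); last first.
  rewrite /B -seqsumB; apply: eq_seqsum => r _; rewrite -seqsumB; apply: eq_seqsum => s _.
  by rewrite -mulrBl /ok' -(addn1 i) iotaD all_cat /= andbT indB.
(* The upper row is cut before column [i] and the lower row after it, so the new lengths are [o - 1]
   and [p + q - o + 1]. *)
rewrite (@seqsum_split _ _ i p); last by lia.
rewrite (@seqsum_split _ _ i o.-1); last by lia.
transitivity (T i (fun r1 => T (p - i) (fun r2 => T (q - o + i).+1 (fun s1 =>
    T (o.-1 - i) (fun s2 => Phi (r1 ++ r2) (s1 ++ s2)))))).
  apply: eq_seqsum => r1 _; apply: eq_seqsum => r2 _.
  rewrite (@seqsum_split _ _ (q - o + i).+1 q); last by lia.
  by have -> : (q - (q - o + i).+1 = o.-1 - i)%N by lia.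
transitivity (T i (fun r1 => T (o.-1 - i) (fun s2 => T (q - o + i).+1 (fun s1 =>
    T (p - i) (fun r2 => Psi (r1 ++ s2) (s1 ++ r2)))))); last first.
  apply: eq_seqsum => r1 _; apply: eq_seqsum => s2 _.
  rewrite (@seqsum_split _ _ (q - o + i).+1 (p + q - o.-1)); last by lia.
  by have -> : (p + q - o.-1 - (q - o + i).+1 = p - i)%N by lia.
rewrite seqsum4; apply: eq_seqsum => r1 sr1; apply: eq_seqsum => s2 ss2.
apply: eq_seqsum => s1 ss1; apply: eq_seqsum => r2 sr2.
rewrite /Phi /Psi tail_swap // !wt_cat (@g_suffix r1 s1) ?sr2; last by lia.
rewrite (@d_prefix s1 s2 r2) ?ss1; last by lia.
by congr (_ * (_ * _ * _)); ring.
Qed.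

(** Telescoping [two_row_step] over the [o] columns gives [A 0 - A o = B 0 - B o], where [A 0] and
    [B 0] carry no column condition and factor. *)
Lemma two_rows :
  T p (fun r => (sorted leq r)%:R * wt r * g r) *
  T q (fun s => (sorted leq s)%:R * wt s * d s) =
  T p (fun r => (sorted leq r)%:R * wt r * g r *
     T q (fun s => (sorted leq s && overlap_ok o r s)%:R * wt s * d s)) +
  T o.-1 (fun w => (sorted leq w)%:R * wt w) *
  T (p + q - o.-1) (fun v => (sorted leq v)%:R * wt v * g v * d v).
Proof.
transitivity (A 0).
  rewrite /A -seqsumMr; apply: eq_seqsum => r _; rewrite -seqsumMl.
  apply: eq_seqsum => s _; rewrite /= andbT; do 2!case: (sorted _ _); rewrite /=; ring.
have -> : A 0 = A o + (B 0 - B o).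
  apply/eqP; rewrite addrC -subr_eq -opprB -[B 0 - _]opprB eqr_opp; apply/eqP.
  rewrite -!telescope_sumr // !big_mkord; apply: eq_bigr => i _; apply: oppr_inj.
  by rewrite !opprB; apply: two_row_step.
congr (_ + _).
  apply: eq_seqsum => r _; rewrite -seqsumMl; apply: eq_seqsum => s ss.
  rewrite /ok /overlap_ok ss.
  do 2!case: (sorted _ _); rewrite /= ?mul0r ?mulr0 //; case: all; rewrite /=; ring.
have -> : B o = 0.
  rewrite -[RHS](seqsum0 _ N o.-1); apply: eq_seqsum => w _.
  rewrite -[RHS](seqsum0 _ N (p + q - o.-1)); apply: eq_seqsum => v _.
  have -> : ok' o w v = false; last by rewrite !andbF mul0r.
  apply/negbTE/allPn; exists o.-1; last by rewrite ltnn.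
  by rewrite mem_iota; lia.
rewrite subr0 /B -seqsumMr; apply: eq_seqsum => r _; rewrite -seqsumMl.
apply: eq_seqsum => s _; rewrite /= andbT; do 2!case: (sorted _ _); rewrite /=; ring.
Qed.

End TwoRows.

(* Generating function of the fillings of the rows [al], top to bottom, placed
   below a row [r]; [be] lists the overlap with [r] followed by those of [al]. *)
Fixpoint fillsum (al be r : seq nat) : R :=
  if al is p :: al' then
    T p (fun s => (sorted leq s && overlap_ok (head 0%N be) r s)%:R * wt s
                  * fillsum al' (behead be) s)
  else 1.

Lemma fillsum_prefix al be s t t' : nilp al || (head 0%N be <= size s)%N ->
  fillsum al be (s ++ t) = fillsum al be (s ++ t').
Proof.
case: al => //= p al le_bs; apply: eq_seqsum => v _.
congr ((_ && _)%:R * _ * _); apply: eq_in_all => i; rewrite mem_iota add0n /= => lt_i.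
by rewrite !nth_cat !(leq_trans lt_i).
Qed.

Definition skewsum al be : R := fillsum al (0%N :: be) [::].

(** Induction strips the rows of [U] down to [two_rows], with [g] the strictness against the row
    above and [d] the sum over the rows below. The bounds on the adjacent overlaps are the locality
    conditions on [g] and [d]. *)
Lemma fillsum_two_rows U be p q o D de r : (0 < o <= minn p q)%N ->
  size be = (size U).+1 -> (last 0 be + o <= p.+1)%N ->
  nilp D || (head 0 de + o <= q.+1)%N ->
  fillsum (U ++ [:: p]) be r * fillsum (q :: D) (0%N :: de) [::] =
  fillsum (U ++ [:: p, q & D]) (be ++ o :: de) r +
  fillsum [:: o.-1] [:: 0%N] [::] * fillsum (U ++ (p + q - o.-1)%N :: D) (be ++ de) r.
Proof.
rewrite leq_min => /and3P[o_gt0 le_op le_oq].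
elim: U be r => [|u U IH] [|b be] r //=.
  case: be => //= _ le_bp le_dq.
  pose g s : R := (overlap_ok b r s)%:R; pose d := fillsum D de.
  have gP u u' t : (p < size t + o)%N -> g (u ++ t) = g (u' ++ t).
    move=> lt_p; rewrite /g; congr ((nat_of_bool _)%:R); apply: eq_in_all => i _.
    have le_bt : (b <= size t)%N by lia.
    by rewrite !size_cat -!addnBA // -!addnA !nth_cat !ltnNge !leq_addr /= !addKn.
  have dP s t t' : (q < size s + o)%N -> d (s ++ t) = d (s ++ t').
    move=> lt_q; apply: fillsum_prefix; case: (nilp D) le_dq => //=; lia.
  have := two_rows o_gt0 le_op le_oq gP dP.
  rewrite /g /d => E.
  transitivity (T p (fun r1 => (sorted leq r1)%:R * wt r1 * (overlap_ok b r r1)%:R) *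
     T q (fun s => (sorted leq s)%:R * wt s * fillsum D de s)).
    congr (_ * _); apply: eq_seqsum => s _; rewrite ?andbT //.
    by rewrite mulr1 -mulrA [wt _ * _]mulrC mulrA -natrM mulnb.
  rewrite E; congr (_ + _ * _).
  - by apply: eq_seqsum => s _; rewrite -[_ * wt s * _]mulrA [wt _ * _]mulrC mulrA -natrM mulnb.
  - by apply: eq_seqsum => s _; rewrite andbT mulr1.
  - by apply: eq_seqsum => s _; rewrite -[_ * wt s * _]mulrA [wt _ * _]mulrC mulrA -natrM mulnb.
move=> [sbe] le_bp le_dq; rewrite -seqsumMr -seqsumMl -seqsumD; apply: eq_seqsum => s _.
rewrite -mulrA IH //; last by case: be sbe le_bp.
by rewrite mulrDr; congr (_ + _); rewrite mulrCA.
Qed.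

End RowSums.

(** * Coefficients of skew Schur functions *)

Definition shape_ok (al be : seq nat) :=
  forall i, i.+1 < size al -> nth 0 be i <= minn (nth 0 al i) (nth 0 al i.+1).

Lemma shape_ok_behead p al be : shape_ok (p :: al) be -> shape_ok al (behead be).
Proof. by move=> ok i lt_i; rewrite nth_behead; apply: (ok i.+1). Qed.

Definition right_end al be := (head (0, 0) (rows al be)).2.
(** The column where a row placed on top of [al] starts. Truncation gives 0 for empty [al], so the
    bottom row is no special case in [rows_cons]. *)
Definition left_end al be := right_end al (behead be) - head 0 be.

Lemma rows_cons p al be :
  rows (p :: al) be = (left_end al be, left_end al be + p) :: rows al (behead be).
Proof. by case: al => //; rewrite /left_end /right_end /= sub0n. Qed.

Lemma right_end_cons p al be : right_end (p :: al) be = left_end al be + p.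
Proof. by rewrite /right_end rows_cons. Qed.

Lemma cells_cons p al be : cells (p :: al) be =
  [seq (0, left_end al be + j) | j <- iota 0 p] ++
  [seq (c.1.+1, c.2) | c <- cells al (behead be)].
Proof.
rewrite /cells rows_cons /= addKn; congr (_ ++ _).
  by rewrite -[left_end _ _ in LHS]addn0 iotaDl -map_comp.
rewrite -[1]addn0 iotaDl -map_comp map_flatten -map_comp; congr flatten.
by apply: eq_map => i /=; rewrite -map_comp.
Qed.

Lemma size_cells al be : size (cells al be) = sumn al.
Proof.
elim: al be => [|p al IH] be //; rewrite cells_cons size_cat !size_map size_iota.
by rewrite IH.
Qed.

Lemma nth_cells_top p al be k : k < p ->
  nth (0, 0) (cells (p :: al) be) k = (0, left_end al be + k).
Proof.
move=> lt_kp; rewrite cells_cons nth_cat size_map size_iota lt_kp.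
by rewrite (nth_map 0) ?size_iota // nth_iota.
Qed.

Lemma nth_cells_below p al be k : p <= k -> k < p + sumn al ->
  nth (0, 0) (cells (p :: al) be) k =
  let c := nth (0, 0) (cells al (behead be)) (k - p) in (c.1.+1, c.2).
Proof.
move=> le_pk lt_k; rewrite cells_cons nth_cat size_map size_iota ltnNge le_pk /=.
by rewrite (nth_map (0, 0)) // size_cells; lia.
Qed.

Lemma right_end_step p al be : shape_ok (p :: al) be ->
  right_end al (behead be) <= left_end al be + p.
Proof.
case: al => [|p' al] // /(_ 0 isT) /=; rewrite nth0 leq_min => /andP[le_bp _].
by rewrite /left_end; lia.
Qed.

(** Right ends weakly decrease downwards; hence a top-row cell with a cell somewhere beneath it must
    lie in the overlap. *)
Lemma cells_column al be k : shape_ok al be -> k < sumn al ->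
  (nth (0, 0) (cells al be) k).2 < right_end al be.
Proof.
elim: al be k => [|p al IH] be k //= ok lt_k.
rewrite right_end_cons; case: (ltnP k p) => [lt_kp|le_pk].
  by rewrite nth_cells_top //= ltn_add2l.
rewrite nth_cells_below //=.
apply: leq_trans (right_end_step ok); apply: IH; first exact: shape_ok_behead ok.
lia.
Qed.

Definition ssyt (cs : seq (nat * nat)) (s : seq nat) : bool :=
  [forall k : 'I_(size cs), forall l : 'I_(size cs),
     let p := nth (0, 0) cs k in let q := nth (0, 0) cs l in
     [&& ((p.1 == q.1) && (p.2 < q.2)) ==> (nth 0 s k <= nth 0 s l)
       & ((p.2 == q.2) && (p.1 < q.1)) ==> (nth 0 s k < nth 0 s l)]].

Lemma ssytP al be s :
  reflect (forall k l, k < sumn al -> l < sumn al ->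
     let p := nth (0, 0) (cells al be) k in let q := nth (0, 0) (cells al be) l in
     (p.1 = q.1 -> p.2 < q.2 -> nth 0 s k <= nth 0 s l) /\
     (p.2 = q.2 -> p.1 < q.1 -> nth 0 s k < nth 0 s l))
   (ssyt (cells al be) s).
Proof.
apply: (iffP forallP) => [h k l|h k].
  rewrite -(size_cells al be) => lt_k lt_l.
  have /forallP/(_ (Ordinal lt_l))/=/andP[/implyP h1 /implyP h2] := h (Ordinal lt_k).
  by split=> /eqP e1 e2; [apply: h1 | apply: h2]; rewrite e1.
apply/forallP => l; have := h k l; rewrite -(size_cells al be) !ltn_ord.
move=> /(_ isT isT) [h1 h2] /=.
by apply/andP; split; apply/implyP => /andP[/eqP]; [apply: h1 | apply: h2].
Qed.

(* Strictness in the columns only has to be checked between consecutive rows,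
   because the cells of a column of a skew shape are contiguous. *)
Lemma ssyt_cons p al be s1 s2 : shape_ok (p :: al) be -> size s1 = p ->
  size s2 = sumn al ->
  ssyt (cells (p :: al) be) (s1 ++ s2) =
  [&& sorted leq s1, nilp al || overlap_ok (head 0 be) s1 (take (head 0 al) s2)
    & ssyt (cells al (behead be)) s2].
Proof.
move=> ok ss1 ss2.
have nth1 k : k < p -> nth 0 (s1 ++ s2) k = nth 0 s1 k by rewrite nth_cat ss1 => ->.
have nth2 k : p <= k -> nth 0 (s1 ++ s2) k = nth 0 s2 (k - p).
  by move=> le_pk; rewrite nth_cat ss1 ltnNge le_pk.
have le_bmin : al = [::] \/ (head 0 be <= p /\ head 0 be <= head 0 al).
  case: al ok {ss2} => [|p' al] ok; [by left|right].
  by have := ok 0 isT; rewrite /= nth0 leq_min => /andP.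
apply/ssytP/and3P => [h|[sort1 ov12 /ssytP h]].
  split.
  - apply/(sortedP 0) => i; rewrite ss1 => lt_i.
    have [||+ _] := h i i.+1; rewrite /=; try lia.
    by rewrite !nth_cells_top ?nth1 //=; [apply; lia | lia..].
  - case: al ok ss2 h le_bmin => [|p' al] //= ok ss2 h [|[le1 le2]] //.
    apply/allP => t; rewrite mem_iota add0n /= => lt_t.
    rewrite size_takel; last by lia.
    rewrite nth_take; last by lia.
    (* This is the position of the box directly below box [t]: the top row fills the first [p]
       positions, and the overlap ends the next row. *)
    have [||_ +] := h t (p + (p' - head 0 be + t)); try lia.
    rewrite nth_cells_top; last by lia.
    rewrite nth_cells_below /=; [|lia..].
    rewrite nth1; last by lia.
    rewrite nth2; last by lia.
    rewrite addKn nth_cells_top /=; last by lia.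
    apply; last by [].
    rewrite {1}/left_end right_end_cons; lia.
  - apply/ssytP => k l lt_k lt_l.
    have [||h1 h2] := h (p + k) (p + l); rewrite ?ltn_add2l //.
    move: h1 h2; rewrite !nth2 ?leq_addr // !nth_cells_below ?leq_addr ?ltn_add2l //= !addKn.
    move=> h1 h2; split=> [e1|]; first by apply: h1; rewrite e1.
    by move=> e; apply: h2.
move=> k l lt_k lt_l /=; case: (ltnP k p) => [lt_kp|le_pk]; case: (ltnP l p) => [lt_lp|le_pl].
- rewrite !nth_cells_top // !nth1 //=; split=> // _; rewrite ltn_add2l => lt_kl.
  by apply: (sorted_leq_nth leq_trans leqnn) => //; rewrite ?inE ?ss1 // ltnW.
- rewrite nth_cells_top // nth_cells_below // nth1 // nth2 //=; split=> // e _.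
  have lt_l' : l - p < sumn al by move: lt_l => /=; lia.
  have := cells_column (shape_ok_behead ok) lt_l'; rewrite -e => lt_r.
  case: al ok ss2 h le_bmin ov12 lt_k lt_l lt_l' e lt_r => [|p' al] //= ok ss2 h [|[le1 le2]] // ov12 lt_k lt_l lt_l' e lt_r.
  have lt_kb : k < head 0 be by move: lt_r; rewrite /left_end; lia.
  move/allP/(_ k): ov12; rewrite mem_iota add0n /= lt_kb => /(_ isT).
  rewrite size_takel; last by lia.
  rewrite nth_take; last by lia.
  move=> /leq_trans -> //.
  (* Either [l] is the box directly below [k], or that box lies between them in the same column and
     the inequalities chain. *)
  have [lt_lp'|le_pl'] := ltnP (l - p) p'.
    move: e; rewrite nth_cells_top //= /left_end right_end_cons => e.
    by have -> : p' - head 0 be + k = l - p by rewrite /left_end in e lt_r; lia.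
  have [||_ h2] := h (p' - head 0 be + k) (l - p); try lia.
  apply: ltnW; apply: h2; rewrite nth_cells_top /=; try lia.
    by rewrite -e /left_end right_end_cons /left_end; lia.
  by rewrite nth_cells_below.
- by rewrite nth_cells_below // nth_cells_top.
- rewrite !nth_cells_below //= !nth2 //.
  have [||h1 h2] := h (k - p) (l - p); move: lt_k lt_l => /=; lia.
Qed.

(** * From sums over row fillings to coefficients of monomials *)

Section Coefficient.
Local Open Scope ring_scope.
Variables (R : comNzRingType) (N : nat) (x : nat -> R).

Lemma seqsum_ffun p (F : seq nat -> R) :
  seqsum N p F = \sum_(f : {ffun 'I_p -> 'I_N}) F [seq val (f k) | k <- enum 'I_p].
Proof.
transitivity (\sum_(t : p.-tuple 'I_N) F (map val t)).
  elim: p F => [|p IH] F /=.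
    by rewrite (big_pred1 [tuple]) // => t; rewrite [t]tuple0; apply/esym/eqP.
  under eq_bigr => i _ do rewrite IH.
  rewrite pair_big /= (reindex (fun t : p.+1.-tuple 'I_N => (thead t, [tuple of behead t]))) /=.
    by apply: eq_bigr => t _; rewrite [t in RHS]tuple_eta.
  exists (fun u : 'I_N * p.-tuple 'I_N => [tuple of u.1 :: u.2]) => [t _|[i t] _] /=.
    by rewrite [RHS]tuple_eta.
  by congr pair; apply: val_inj.
rewrite (reindex (fun f : {ffun 'I_p -> 'I_N} => [tuple f k | k < p])) /=.
  by apply: eq_bigr => f _; rewrite -map_comp.
exists (fun t : p.-tuple 'I_N => [ffun k => tnth t k]) => [f _|t _].
  by apply/ffunP => k; rewrite ffunE tnth_mktuple.
by apply: eq_from_tnth => k; rewrite tnth_mktuple ffunE.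
Qed.

Lemma fillsum_ssyt al be r : shape_ok al (behead be) ->
  fillsum N x al be r = seqsum N (sumn al) (fun s =>
    (ssyt (cells al (behead be)) s &&
      (nilp al || overlap_ok (head 0%N be) r (take (head 0%N al) s)))%:R * wt x s).
Proof.
elim: al be r => [|p al IH] be r ok /=.
  rewrite andbT /wt big_nil mulr1.
  by have -> : ssyt (cells [::] (behead be)) [::] by apply/forallP; case.
rewrite seqsum_cat; apply: eq_seqsum => s1 ss1.
rewrite IH; last exact: shape_ok_behead ok.
rewrite -seqsumMl; apply: eq_seqsum => s2 ss2.
rewrite ssyt_cons // take_size_cat // wt_cat.
case: (ssyt _ _); case: (sorted leq _); case: (overlap_ok _ r _); case: (_ || _);
  rewrite /= ?mul0r ?mulr0 ?mul1r //.
Qed.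

End Coefficient.

Section SkewCoefficient.
Local Open Scope ring_scope.
Variable c : seq nat.
Local Notation N := (size c).

(* Indexed by [nat] so that no default element of ['I_N] is needed. *)
Definition var (i : nat) : {mpoly int[N]} := 'X_[[multinom (val j == i : nat) | j < N]].

Definition content_mnm : 'X_{1..N} := [multinom nth 0%N c j | j < N].

(** Each filling contributes the monomial of its content, so the coefficient at [content_mnm] counts
    the tableaux of content [c]. *)
Lemma skew_coef_skewsum al be : shape_ok al be ->
  (skew_coef al be c)%:Z = (skewsum N var al be)@_content_mnm.
Proof.
move=> ok; rewrite /skewsum fillsum_ssyt // -(size_cells al be) seqsum_ffun raddf_sum /=.
rewrite /skew_coef -natz -sum1_card natr_sum big_mkcond /=; apply: eq_bigr => f _.
set s := [seq _ | _ <- _].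
have nth_s (k : 'I_(size (cells al be))) : nth 0%N s k = f k.
  by rewrite (nth_map k) ?size_enum_ord // nth_ord_enum.
rewrite inE; have -> : is_ssyt f = ssyt (cells al be) s.
  by apply: eq_forallb => k; apply: eq_forallb => l; rewrite !nth_s.
have -> : (nilp al || overlap_ok 0 [::] (take (head 0%N al) s)) = true by rewrite orbT.
rewrite andbT; case: (ssyt _ _); last by rewrite mul0r mcoeff0.
rewrite mul1r.
have -> : wt var s = 'X_[\sum_(k < size (cells al be)) U_(f k)%MM].
  rewrite /wt big_map big_enum /=.
  rewrite (big_morph (fun m : 'X_{1..N} => 'X_[m] : {mpoly int[N]})
             (@mpolyXD N int) (@mpolyX0 N int)); apply: eq_bigr => k _.
  by congr 'X_[_]; apply/mnmP => j; rewrite !mnmE eq_sym.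
rewrite mcoeffX; set m := (\sum_(k < _) _)%MM.
have mE (j : 'I_N) : m j = #|[pred k | f k == j]|.
  by rewrite mnm_sumE -sum1_card [RHS]big_mkcond; apply: eq_bigr => k _; rewrite mnm1E.
suff -> : has_content f = (m == content_mnm) by case: (_ == _).
apply/forallP/eqP => [h|e j]; last by rewrite -mE e mnmE.
by apply/mnmP => j; rewrite mE mnmE; apply/eqP.
Qed.

End SkewCoefficient.

Lemma shape_ok_cons p al be : nilp al || (head 0 be <= minn p (head 0 al)) ->
  shape_ok al (behead be) -> shape_ok (p :: al) be.
Proof.
move=> h ok [|i] /= lt_i; last by rewrite -nth_behead; apply: ok.
by rewrite !nth0; case: al h lt_i {ok}.
Qed.

Lemma shape_ok_ones al1 al be : all (leq 1) (al1 ++ al) -> shape_ok al be ->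
  shape_ok (al1 ++ al) (nseq (size al1) 1 ++ be).
Proof.
move=> pos ok; elim: al1 pos => [|p al1 IH] //= /andP[p0 pos].
apply: shape_ok_cons; last exact: IH.
by case: (al1 ++ al) pos => //= q ? /andP[q0 _]; rewrite leq_min p0.
Qed.

Lemma sum_parity (V : zmodType) (F : nat -> V) n : 0 < n ->
  (\sum_(2 <= i < n.+1) F i = \sum_(1 <= k < n./2.+1) F k.*2
    + \sum_(1 <= k < n.-1./2.+1) F k.*2.+1)%R.
Proof.
case: n => // n _; elim: n => [|n IH]; first by rewrite !big_geq ?addr0.
rewrite big_nat_recr //= IH /= uphalf_half.
have := odd_double_half n; case: (odd n) => e.
  rewrite [in RHS](@big_nat_recr _ _ _ n./2.+1 1 (fun k => F k.*2.+1)) //= addrA.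
  by congr (_ + F _)%R; lia.
rewrite [in RHS](@big_nat_recr _ _ _ n./2.+1 1 (fun k => F k.*2)) //= addrAC.
by congr (_ + F _ + _)%R; lia.
Qed.

(** [(mu, y)] is [(ka-1, ka)] or [(ka, (k+1)a-1)]: [a > 1] gives positivity in the first case and
    strictness in the second. *)
Lemma mu_bounds a i : 1 < a -> 1 < i -> 0 < mu a i < (i * a).-1 - mu a i.
Proof.
move=> a1; rewrite -(odd_double_half i); set k := i./2.
case: (odd i) => /= i1; rewrite ?add1n ?add0n.
  rewrite mu_odd; have : 0 < k * a by rewrite muln_gt0 (ltnW a1); lia.
  by rewrite mulSn -doubleMl; lia.
rewrite mu_even; have : 1 < k * a by rewrite (leq_trans a1) // leq_pmull //; lia.
by rewrite -doubleMl; lia.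
Qed.

(** * Gluing along overlaps of size 1 *)

Section Pieces.
Local Open Scope ring_scope.
Variables (R : comNzRingType) (N : nat) (x : nat -> R).
Variables (sigma tau sigmab taub : seq nat) (a : nat).
Hypotheses (tau_pos : all (fun x => 0 < x)%N tau)
  (size_sigmab : size sigmab = size sigma) (size_taub : size taub = size tau)
  (last_sigmab : (0 < size sigma)%N -> last 0%N sigmab = 1%N)
  (head_taub : (0 < size tau)%N -> head 0%N taub = 1%N)
  (taub_le : forall i, (0 < i < size tau)%N ->
            (nth 0%N taub i <= minn (nth 0%N tau i) (nth 0%N tau i.-1))%N).

Local Notation F := (skewsum N x).

Lemma skewsum_join U be p q o D de : (0 < o <= minn p q)%N ->
  size be = size U -> (last 0%N be + o <= p.+1)%N ->
  nilp D || (head 0%N de + o <= q.+1)%N ->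
  F (U ++ [:: p]) be * F (q :: D) de =
  F (U ++ [:: p, q & D]) (be ++ o :: de) +
  F [:: o.-1] [::] * F (U ++ (p + q - o.-1)%N :: D) (be ++ de).
Proof.
move=> ho sbe hp hq.
by rewrite /skewsum (@fillsum_two_rows _ _ _ _ (0%N :: be) p q o D de) //= sbe.
Qed.

Lemma skewsum0 : F [:: 0%N] [::] = 1.
Proof. by rewrite /skewsum /= /wt big_nil !mulr1. Qed.

Definition one_row m := F [:: m] [::].
(** The overlaps joining [w] to [sigma] and [tau] are the last entry of [sigmab] and the first of
    [taub], so only the inner ones are added. *)
Definition left_part w := F (sigma ++ w) (sigmab ++ nseq (size w).-1 1%N).
Definition right_part w := F (w ++ tau) (nseq (size w).-1 1%N ++ taub).
Definition full w := F (sigma ++ w ++ tau) (sigmab ++ nseq (size w).-1 1%N ++ taub).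

Lemma last_ones k : (last 0 (sigmab ++ nseq k 1) <= 1)%N.
Proof.
rewrite last_cat; case: k => [|k] /=; last by elim: k.
have := last_sigmab; rewrite -size_sigmab; case: sigmab => //= b s -> //.
Qed.

Lemma head_ones k : nilp (nseq k a ++ tau) || (head 0 (nseq k 1 ++ taub) <= 1)%N.
Proof.
case: k => [|k] //=.
by case: tau head_taub => //= t ta ->.
Qed.

(** At [o = 1] the short row is empty and contributes 1: a product is the glued shape plus the
    merged one. *)
Lemma skewsum_join1 U be p q D de : (0 < minn p q)%N ->
  size be = size U -> (last 0%N be <= p)%N -> nilp D || (head 0%N de <= q)%N ->
  F (U ++ [:: p]) be * F (q :: D) de =
  F (U ++ [:: p, q & D]) (be ++ 1%N :: de) + F (U ++ (p + q)%N :: D) (be ++ de).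
Proof.
move=> ho sbe hp hq.
by rewrite (@skewsum_join _ _ _ _ 1%N) ?addn1 ?skewsum0 ?mul1r ?subn0.
Qed.

Lemma full_join u p q k : (0 < p)%N -> (0 < q)%N ->
  left_part (rcons u p) * right_part (q :: nseq k a) =
  full (u ++ [:: p, q & nseq k a]) + full (u ++ (p + q)%N :: nseq k a).
Proof.
move=> p0 q0; have := last_ones (size u); have := head_ones k => hk lu.
have := @skewsum_join1 (sigma ++ u) (sigmab ++ nseq (size u) 1%N) p q
  (nseq k a ++ tau) (nseq k 1%N ++ taub).
rewrite leq_min p0 q0 !size_cat size_nseq size_sigmab => /(_ isT erefl).
rewrite (leq_trans lu p0) => /(_ isT) E.
rewrite /left_part /right_part /full -cats1 !size_cat /= !size_nseq addn1 /= catA E.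
  have -> : (size u + k.+2).-1 = (size u + k.+1)%N by lia.
  have -> : (size u + k.+1).-1 = (size u + k)%N by lia.
  by rewrite !nseqD -!catA.
by case/orP: hk => [->//|hk]; rewrite (leq_trans hk q0) orbT.
Qed.

Lemma left_join u p m : (0 < p)%N -> (0 < m)%N ->
  left_part (rcons u p) * one_row m =
  left_part (rcons (rcons u p) m) + left_part (rcons u (p + m)%N).
Proof.
move=> p0 m0; have lu := last_ones (size u).
have := @skewsum_join1 (sigma ++ u) (sigmab ++ nseq (size u) 1%N) p m [::] [::].
rewrite leq_min p0 m0 !size_cat size_nseq size_sigmab => /(_ isT erefl).
rewrite (leq_trans lu p0) => /(_ isT isT) E.
rewrite /left_part -!cats1 !size_cat /= addn1 /= catA E.
by rewrite !cats0 nseqD -!catA.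
Qed.

Lemma right_join m q k : (0 < m)%N -> (0 < q)%N ->
  one_row m * right_part (q :: nseq k a) =
  right_part [:: m, q & nseq k a] + right_part ((m + q)%N :: nseq k a).
Proof.
move=> m0 q0; have hk := head_ones k.
have := @skewsum_join1 [::] [::] m q (nseq k a ++ tau) (nseq k 1%N ++ taub).
rewrite leq_min m0 q0 /right_part /= !size_nseq; apply=> //.
by case/orP: hk => [->//|hk]; rewrite (leq_trans hk q0) orbT.
Qed.

(** The overlap [o = m + 1] is the whole upper row, so the swapped long row has [y + 1] boxes. *)
Lemma equal_rows_term j m y : (m < y)%N ->
  F (sigma ++ [:: m.+1; y] ++ nseq j a ++ tau)
    (sigmab ++ [:: m.+1] ++ nseq j 1%N ++ taub) =
  left_part [:: m.+1] * right_part (y :: nseq j a) - one_row m * full (y.+1 :: nseq j a).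
Proof.
move=> lt_my; have hk := head_ones j; have := last_ones 0; rewrite cats0 => ls.
rewrite /left_part /right_part /full /= !size_nseq cats0.
rewrite (@skewsum_join _ _ _ _ m.+1) //=.
- have -> : (m.+1 + y - m = y.+1)%N by lia.
  by rewrite addrK.
- by rewrite leq_min leqnn.
- lia.
- by case/orP: hk => [->//|hk]; apply/orP; right; lia.
Qed.

(* The merged rows are eliminated with [o = 1] from the products with the
   function of [tau]. *)
Lemma merged_term u p m : (0 < size tau)%N -> (0 < m < p)%N ->
  F (sigma ++ u ++ [:: p; (m + head 0 tau)%N] ++ behead tau)
    (sigmab ++ nseq (size u) 1%N ++ [:: m.+1] ++ behead taub) =
  one_row m * full (rcons u p) - left_part (rcons u p) * right_part [:: m].
Proof.
move=> tau0 /andP[m0 lt_mp].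
have [t1 [tau' [taub' [Etau Etaub t1_gt0 le_t]]]] : exists t1 tau' taub',
  [/\ tau = t1 :: tau', taub = 1%N :: taub', (0 < t1)%N & nilp tau' || (head 0%N taub' <= t1)%N].
  have hb := head_taub tau0; case: tau taub tau0 hb tau_pos size_taub taub_le => [|t1 tau'] //.
  move=> [|b taub'] //= _ -> /andP[t1_gt0 _] _ le_t; exists t1, tau', taub'; split=> //.
  case: tau' le_t => // t2 tau' /(_ 1%N isT) /=; rewrite nth0 leq_min => /andP[].
  by [].
have lu := last_ones (size u).
have su : size (sigmab ++ nseq (size u) 1%N) = size (sigma ++ u).
  by rewrite !size_cat size_nseq size_sigmab.
have p0 : (0 < p)%N by apply: leq_ltn_trans lt_mp.
(* [E3] contains the wanted term; [E1] and [E2] eliminate the rows [m + t1] and [p + t1], and the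
   triple product with the function of [tau] cancels. *)
have E1 := @skewsum_join1 [::] [::] m t1 tau' taub'.
have E2 := @skewsum_join1 (sigma ++ u) (sigmab ++ nseq (size u) 1%N) p t1 tau' taub'.
have E3 := @skewsum_join (sigma ++ u) (sigmab ++ nseq (size u) 1%N) p (m + t1) m.+1 tau' taub'.
rewrite leq_min m0 t1_gt0 /= le_t in E1.
rewrite leq_min p0 t1_gt0 /= le_t su (leq_trans lu p0) in E2.
rewrite su addnS ltnS leq_min lt_mp -addn1 leq_add2l t1_gt0 in E3.
have {}E1 := E1 isT erefl isT isT; have {}E2 := E2 isT erefl isT isT.
rewrite /one_row /full /left_part /right_part Etau Etaub /= -cats1 !size_cat /= addn1 /=.
have lp : (last 0 (sigmab ++ nseq (size u) 1) + m < p.+1)%N by lia.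
have lt : nilp tau' || (head 0 taub' + (m + 1) <= (m + t1).+1)%N.
  by case/orP: le_t => [->//|le_t]; apply/orP; right; lia.
have {E3 lp lt} := E3 isT erefl lp lt.
rewrite addn1 /= (_ : p + (m + t1) - m = p + t1)%N; last by lia.
rewrite -!catA /= in E2 *.
move=> /esym/(canRL (addrK _)) ->.
rewrite [F [:: m, t1 & tau'] _](canRL (addrK _) (esym E1)).
rewrite [F (sigma ++ u ++ [:: p, t1 & tau']) _](canRL (addrK _) (esym E2)).
ring.
Qed.

(** Without [tau], [full] is [left_part] and [right_part [:: m]] is [one_row m]. *)
Lemma merged_term_nil w m : tau = [::] ->
  one_row m * full w - left_part w * right_part [:: m] = 0.
Proof.
move=> e; have /size0nil et : size taub = 0%N by rewrite size_taub e.
by rewrite /one_row /full /left_part /right_part e et !cats0 mulrC subrr.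
Qed.

(** * The recurrence applied to ribbons attached to [sigma] and [tau] *)

Hypothesis a_gt1 : (1 < a)%N.

Lemma one_row0 : one_row 0 = 1. Proof. exact: skewsum0. Qed.

(* The value 0 at 0 makes the first block of [block_sum] the difference on the
   left-hand side of the theorem. *)
Definition left_row m := if m is 0 then 0 else left_part [:: m.+1].
Definition right_row m := if m is 0 then 0 else right_part [:: m].

(* The row lengths [a + 1, a, .., a, y] with [j] rows above [y]; the extra box
   goes to [y] when [j = 0]. *)
Definition raised j y : seq nat :=
  if j is j'.+1 then a.+1 :: rcons (nseq j' a) y else [:: y.+1].

Lemma rcons_nseq k (y : nat) : rcons (nseq k y) y = y :: nseq k y.
Proof. by elim: k => //= k ->. Qed.

Lemma raisedP j : exists u p, [/\ (0 < p)%N, raised j a = rcons u p &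
  forall y, raised j.+1 y = rcons (rcons u p) y /\ raised j (y + a)%N = rcons u (p + y)%N].
Proof.
case: j => [|j] /=.
  by exists [::], a.+1; split=> // y; split=> //=; rewrite addSn addnC.
exists (a.+1 :: nseq j a), a; split; [lia|by []|move=> y; split].
  by rewrite -rcons_cons -(rcons_nseq j).
by rewrite addnC.
Qed.

Lemma peel_right j y : (0 < y)%N ->
  peel a one_row right_row j y = right_part (y :: nseq j a).
Proof.
elim: j y => [|j IH] y y0; first by case: y y0.
rewrite /= !IH ?addn_gt0 ?y0 //; last by lia.
by rewrite mulrC right_join //= ?addrK //; lia.
Qed.

(** [left_row] counts one extra box; peeling the free end leaves it in the row next to [sigma],
    whence [raised]. *)
Lemma peel_left j y : (0 < y)%N ->
  peel a one_row left_row j y = left_part (raised j y).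
Proof.
elim: j y => [|j IH] y y0; first by case: y y0.
rewrite [LHS]/= !IH ?addn_gt0 ?y0 //; last by lia.
have [u [p [p0 -> /(_ y)[-> ->]]]] := raisedP j.
by rewrite left_join // addrK.
Qed.

(** Cutting the last row off one ribbon and the first row off the other leaves merged terms that
    form the same difference at [y + a]. *)
Lemma peel2_full j y : (0 < y)%N ->
  peel2 a one_row left_row right_row j y = full (raised j y) - full (y.+1 :: nseq j a).
Proof.
elim: j y => [|j IH] y y0; first by rewrite subrr.
rewrite [LHS]/= IH ?addn_gt0 ?y0 //.
rewrite peel_right ?peel_left; [|lia..].
have -> : right_row y = right_part (y :: nseq 0 a) by case: y y0.
have -> : left_row y = left_part (rcons [::] y.+1) by case: y y0.
have [u [p [p0 -> /(_ y)[-> ->]]]] := raisedP j.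
rewrite !full_join //=; [|lia..].
rewrite -!cats1 -!catA /= addSn; ring.
Qed.

Let y i := ((i * a).-1 - mu a i)%N.

Definition equal_rows n i := left_part [:: (mu a i).+1] * right_part (y i :: nseq (n - i) a)
  - one_row (mu a i) * full ((y i).+1 :: nseq (n - i) a).

Definition merged n i := one_row (mu a i) * full (raised (n - i) (y i))
  - left_part (raised (n - i) (y i)) * right_part [:: mu a i].

Lemma full_sub n : (1 < n)%N ->
  full (nseq n a) - full (a.+1 :: rcons (nseq (n - 2) a) a.-1) =
  \sum_(2 <= i < n.+1) (equal_rows n i + merged n i).
Proof.
move=> n1; have a0 : (0 < a)%N by apply: ltnW.
have := @block_sum R a one_row left_row right_row a0 one_row0 erefl erefl n.
rewrite big_ltn; last by lia.
(* Here [mu a 1 = 0], so [left_row] and [right_row] vanish and [h 0 = 1] leaves [peel2] alone: minus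
   the left-hand side. *)
have -> : block a one_row left_row right_row (n - 1) (mu a 1) ((1 * a).-1 - mu a 1) =
    full (raised (n - 1) a.-1) - full (a :: nseq (n - 1) a).
  rewrite mul1n subn0 /block /= mul0r mulr0 subr0 add0r one_row0 mul1r peel2_full; last by lia.
  by rewrite prednK.
move=> /eqP; rewrite addr_eq0 => /eqP/(congr1 -%R); rewrite opprK opprB.
case: n n1 => [|[|n]] // _; rewrite !subSS !subn0 => E.
transitivity (full (a :: nseq n.+1 a) - full (raised n.+1 a.-1)) => //; rewrite E.
apply: eq_big_nat => i /andP[i1 _]; have /andP[m0 lt_my] := mu_bounds a_gt1 i1.
rewrite /block peel_right ?peel_left ?peel2_full; [|lia..].
rewrite /equal_rows /merged -/(y i).
have -> : left_row (mu a i) = left_part [:: (mu a i).+1] by case: (mu a i) m0.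
have -> : right_row (mu a i) = right_part [:: mu a i] by case: (mu a i) m0.
ring.
Qed.

End Pieces.

(** * Admissibility of the overlap sequences *)

Section SigmaShapes.
Variables sigma sigmab : seq nat.
Hypotheses (sigma_pos : all (fun x => 0 < x) sigma)
  (size_sigmab : size sigmab = size sigma)
  (last_sigmab : 0 < size sigma -> last 0 sigmab = 1)
  (sigmab_le : forall i, i.+1 < size sigma ->
     nth 0 sigmab i <= minn (nth 0 sigma i) (nth 0 sigma i.+1)).

Lemma shape_ok_sigma p al be : 0 < p -> shape_ok (p :: al) be ->
  shape_ok (sigma ++ p :: al) (sigmab ++ be).
Proof.
move=> p0 ok i; rewrite size_cat /= => lt_i; rewrite !nth_cat size_sigmab.
have [lt_i1|le_i1] := ltnP i.+1 (size sigma).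
  by rewrite (ltnW lt_i1); apply: sigmab_le.
have [lt_is|le_is] := ltnP i (size sigma); last first.
  by rewrite subSn //; apply: ok => /=; lia.
have si : size sigma = i.+1 by lia.
rewrite si subnn /=; have -> : i = (size sigmab).-1 by rewrite size_sigmab si.
rewrite nth_last last_sigmab ?si // leq_min p0 andbT.
by apply: (allP sigma_pos); apply: mem_nth; rewrite size_sigmab si.
Qed.

End SigmaShapes.

Section TauShapes.
Variables tau taub : seq nat.
Hypotheses (tau_pos : all (fun x => 0 < x) tau)
  (size_taub : size taub = size tau)
  (head_taub : 0 < size tau -> head 0 taub = 1)
  (taub_le : forall i, 0 < i < size tau ->
     nth 0 taub i <= minn (nth 0 tau i) (nth 0 tau i.-1)).

Lemma shape_ok_merged p : head 0 tau <= p -> shape_ok (p :: behead tau) (behead taub).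
Proof.
case: tau taub size_taub taub_le => [|t1 tau'] [|b taub'] //= _ le_t le_p [|i] /= lt_i.
  have := le_t 1; rewrite ltnS lt_i => /(_ isT) /=; rewrite !leq_min => /andP[-> /leq_trans->] //.
by have := le_t i.+2; rewrite ltnS lt_i minnC; apply.
Qed.

Lemma shape_ok_tau p : 0 < p -> shape_ok (p :: tau) taub.
Proof.
move=> p0; have := @shape_ok_merged (head 0 tau) (leqnn _).
case: tau head_taub tau_pos => [|t1 tau'] //= ht /andP[t0 _] ok.
by apply: shape_ok_cons => //=; rewrite ht // leq_min p0.
Qed.

Lemma shape_ok_ones_tau u p : all (leq 1) u -> 0 < p ->
  shape_ok (u ++ p :: tau) (nseq (size u) 1 ++ taub).
Proof.
move=> u_pos p0; apply: shape_ok_ones (shape_ok_tau p0).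
by rewrite all_cat u_pos /= p0.
Qed.

End TauShapes.

(** * Coefficients of the displayed terms and final assembly *)

Section Coefficients.
Variables (sigma tau sigmab taub : seq nat) (a : nat) (c : seq nat).
Hypotheses (sigma_pos : all (fun x => 0 < x) sigma)
  (tau_pos : all (fun x => 0 < x) tau)
  (size_sigmab : size sigmab = size sigma) (size_taub : size taub = size tau)
  (last_sigmab : 0 < size sigma -> last 0 sigmab = 1)
  (head_taub : 0 < size tau -> head 0 taub = 1)
  (sigmab_le : forall i, i.+1 < size sigma ->
     nth 0 sigmab i <= minn (nth 0 sigma i) (nth 0 sigma i.+1))
  (taub_le : forall i, 0 < i < size tau ->
     nth 0 taub i <= minn (nth 0 tau i) (nth 0 tau i.-1))
  (a_gt1 : 1 < a).

Lemma shape_ok_equal_rows p q j : 0 < p <= q ->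
  shape_ok (sigma ++ [:: p; q] ++ nseq j a ++ tau) (sigmab ++ [:: p] ++ nseq j 1 ++ taub).
Proof.
move=> /andP[p0 le_pq]; have q0 := leq_trans p0 le_pq.
apply: shape_ok_sigma => //; apply: shape_ok_cons; first by rewrite /= leq_min leqnn.
case: j => [|j]; first exact: shape_ok_tau.
have := shape_ok_ones_tau tau_pos size_taub head_taub taub_le (u := q :: nseq j a) (p := a).
rewrite /= size_nseq q0 => ok.
suff: shape_ok (q :: rcons (nseq j a) a ++ tau) (nseq j.+1 1 ++ taub) by rewrite rcons_nseq.
rewrite cat_rcons; apply: ok; last by lia.
by rewrite all_nseq; lia.
Qed.

Lemma shape_ok_merged_rows u p m : 0 < size tau -> all (leq 1) u -> 0 < m < p ->
  shape_ok (sigma ++ u ++ [:: p; m + head 0 tau] ++ behead tau)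
    (sigmab ++ nseq (size u) 1 ++ [:: m.+1] ++ behead taub).
Proof.
move=> tau0 u_pos /andP[m0 lt_mp].
have t0 : 0 < head 0 tau by case: tau tau0 tau_pos => //= t ? _ /andP[].
have p0 : 0 < p by lia.
have q0 : 0 < m + head 0 tau by lia.
have ok : shape_ok (u ++ [:: p, m + head 0 tau & behead tau])
                   (nseq (size u) 1 ++ m.+1 :: behead taub).
  apply: shape_ok_ones.
    rewrite all_cat u_pos /= p0 q0 /=.
    by case: tau tau_pos => //= t s /andP[].
  apply: shape_ok_cons; first by rewrite /= leq_min lt_mp; lia.
  by apply: (shape_ok_merged size_taub taub_le); lia.
case: u u_pos ok => [|q u] /=; first by move=> _; apply: shape_ok_sigma.
by move=> /andP[q1 _]; apply: shape_ok_sigma.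
Qed.

Local Notation coefc p := (p@_(content_mnm c))%R.
Local Notation eqr n i := (equal_rows (size c) (var c) sigma tau sigmab taub a n i).
Local Notation mrg n i := (merged (size c) (var c) sigma tau sigmab taub a n i).

Lemma equal_rows_coef n i p q : 1 < i -> p = (mu a i).+1 -> q = (i * a).-1 - mu a i ->
  ((skew_coef (sigma ++ [:: p; q] ++ nseq (n - i) a ++ tau)
     (sigmab ++ [:: p] ++ nseq (n - i) 1 ++ taub) c)%N%:Z = coefc (eqr n i))%R.
Proof.
move=> i1 -> ->; have /andP[m0 lt_my] := mu_bounds a_gt1 i1.
rewrite skew_coef_skewsum; last exact: shape_ok_equal_rows.
by rewrite equal_rows_term.
Qed.

(** [u] and [p] stay abstract to cover both the families with rows above, where [u] begins with
    [a + 1], and the final term, where [u] is empty. *)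
Lemma merged_coef n i u p m : 0 < size tau -> 1 < i -> all (leq 1) u -> 
  m = mu a i -> m < p -> raised a (n - i) ((i * a).-1 - mu a i) = rcons u p ->
  ((skew_coef (sigma ++ u ++ [:: p; m + head 0 tau] ++ behead tau)
     (sigmab ++ nseq (size u) 1 ++ [:: m.+1] ++ behead taub) c)%N%:Z
   = coefc (mrg n i))%R.
Proof.
move=> tau0 i1 u_pos em lt_mp e; have /andP[m0 _] := mu_bounds a_gt1 i1.
rewrite -em in m0.
rewrite skew_coef_skewsum; last by apply: shape_ok_merged_rows; rewrite ?m0.
by rewrite merged_term ?m0 // /merged e em.
Qed.

End Coefficients.

Theorem theorem2p13
  (sigma tau sigmab taub : seq nat) (a n : nat)
  (Hsig : all (fun x => 0 < x) sigma) (Htau : all (fun x => 0 < x) tau)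
  (Hsb : size sigmab = size sigma) (Htb : size taub = size tau)
  (Hsb1 : 0 < size sigma -> last 0 sigmab = 1)
  (Htb1 : 0 < size tau -> head 0 taub = 1)
  (Hsbi : forall i, i.+1 < size sigma ->
            nth 0 sigmab i <= minn (nth 0 sigma i) (nth 0 sigma i.+1))
  (Htbi : forall i, 0 < i < size tau ->
            nth 0 taub i <= minn (nth 0 tau i) (nth 0 tau i.-1))
  (Ha : 2 <= a) (Hn : 2 <= n) :
  forall c : seq nat,
  let t1 := head 0 tau in let tau' := behead tau in let taub' := behead taub in
  ((skew_coef (sigma ++ nseq n a ++ tau)
              (sigmab ++ nseq n.-1 1 ++ taub) c)%N%:Z
   - (skew_coef (sigma ++ [:: a.+1] ++ nseq (n - 2) a ++ [:: a.-1] ++ tau)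
                (sigmab ++ nseq n.-1 1 ++ taub) c)%N%:Z)%R
  =
  (\sum_(1 <= k < (n./2).+1)
     (skew_coef (sigma ++ [:: k * a; k * a] ++ nseq (n - 2 * k) a ++ tau)
                (sigmab ++ [:: k * a] ++ nseq (n - 2 * k) 1 ++ taub) c)%N%:Z
   + (if (0 < size tau)%N then
       \sum_(1 <= k < ((n.-1)./2).+1)
         (skew_coef (sigma ++ [:: a.+1] ++ nseq (n - 2 * k - 1) a
                       ++ [:: k * a; k * a - 1 + t1] ++ tau')
                    (sigmab ++ nseq (n - 2 * k) 1 ++ [:: k * a] ++ taub') c)%N%:Z
      else 0)
   + \sum_(1 <= k < ((n.-1)./2).+1)
       (skew_coef (sigma ++ [:: k * a + 1; k.+1 * a - 1] ++ nseq (n - 2 * k - 1) a ++ tau)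
                  (sigmab ++ [:: k * a + 1] ++ nseq (n - 2 * k - 1) 1 ++ taub) c)%N%:Z
   + (if (0 < size tau)%N then
       \sum_(1 <= k < ((n - 2)./2).+1)
         (skew_coef (sigma ++ [:: a.+1] ++ nseq (n - 2 * k - 2) a
                       ++ [:: k.+1 * a - 1; k * a + t1] ++ tau')
                    (sigmab ++ nseq (n - 2 * k - 1) 1 ++ [:: k * a + 1] ++ taub') c)%N%:Z
      else 0)
   + (if (0 < size tau)%N then
       (if odd n then
          (skew_coef (sigma ++ [:: n.+1./2 * a; n.-1./2 * a + t1] ++ tau')
                     (sigmab ++ [:: n.-1./2 * a + 1] ++ taub') c)%N%:Z
        else
          (skew_coef (sigma ++ [:: n./2 * a + 1; n./2 * a - 1 + t1] ++ tau')
                     (sigmab ++ [:: n./2 * a] ++ taub') c)%N%:Z)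
      else 0))%R.
Proof.
move=> c t1 tau' taub'.
have n0 : 0 < n by apply: ltnW.
pose co (p : {mpoly int[size c]}) := (p@_(content_mnm c))%R.
pose E i := co (equal_rows (size c) (@var c) sigma tau sigmab taub a n i).
pose M i := co (merged (size c) (@var c) sigma tau sigmab taub a n i).
have ones_shape u p : all (leq 1) u -> 0 < p ->
    shape_ok (sigma ++ u ++ p :: tau) (sigmab ++ nseq (size u) 1 ++ taub).
  move=> u0 p0; have := shape_ok_ones_tau Htau Htb Htb1 Htbi u0 p0.
  by case: u u0 => [|q u] /= => [_|/andP[q0 _]] ok; apply: shape_ok_sigma ok.
pose B w := full (size c) (@var c) sigma tau sigmab taub w.
have lhs1 : ((skew_coef (sigma ++ nseq n a ++ tau) (sigmab ++ nseq n.-1 1 ++ taub) c)%:Z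
    = co (B (nseq n a)))%R.
  rewrite skew_coef_skewsum /B /full ?size_nseq //.
  have := ones_shape (nseq n.-1 a) a; rewrite size_nseq -cat_rcons rcons_nseq -[_ :: nseq _ _]/(nseq n.-1.+1 a) prednK //.
  by apply; rewrite ?all_nseq; lia.
have lhs2 : ((skew_coef (sigma ++ [:: a.+1] ++ nseq (n - 2) a ++ [:: a.-1] ++ tau)
      (sigmab ++ nseq n.-1 1 ++ taub) c)%:Z
    = co (B (a.+1 :: rcons (nseq (n - 2) a) a.-1)))%R.
  have sz : n.-1 = size (a.+1 :: nseq (n - 2) a) by rewrite /= size_nseq; lia.
  rewrite skew_coef_skewsum; last first.
    by rewrite sz; apply: (ones_shape (a.+1 :: nseq (n - 2) a)); rewrite /= ?all_nseq; lia.
  rewrite /B /full /= size_rcons cat_rcons size_nseq.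
  by have -> : n.-1 = (n - 2).+1 by lia.
have lhs : (co (B (nseq n a)) - co (B (a.+1 :: rcons (nseq (n - 2) a) a.-1)) =
    \sum_(2 <= i < n.+1) E i + \sum_(2 <= i < n.+1) M i)%R.
  rewrite -big_split /= /co -mcoeffB /B full_sub // raddf_sum /=.
  by apply: eq_bigr => i _; rewrite raddfD.
rewrite lhs1 lhs2 lhs (sum_parity _ n0).
have mu2 k : mu a k.*2 = (k * a).-1 by apply: mu_even.
have mu2' k : mu a k.*2.+1 = k * a by apply: mu_odd.
have ka k : 0 < k -> 1 < k * a by move=> k0; rewrite (leq_trans Ha) // leq_pmull.
have E_even : (\sum_(1 <= k < n./2.+1)
     (skew_coef (sigma ++ [:: k * a; k * a] ++ nseq (n - 2 * k) a ++ tau)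
                (sigmab ++ [:: k * a] ++ nseq (n - 2 * k) 1 ++ taub) c)%N%:Z
     = \sum_(1 <= k < n./2.+1) E k.*2)%R.
  apply: eq_big_nat => k /andP[k0 _]; have := ka k k0 => k1.
  by rewrite mul2n; apply: equal_rows_coef => //; rewrite ?mu2 -?doubleMl; lia.
have E_odd : (\sum_(1 <= k < n.-1./2.+1)
       (skew_coef (sigma ++ [:: k * a + 1; k.+1 * a - 1] ++ nseq (n - 2 * k - 1) a ++ tau)
                  (sigmab ++ [:: k * a + 1] ++ nseq (n - 2 * k - 1) 1 ++ taub) c)%N%:Z
     = \sum_(1 <= k < n.-1./2.+1) E k.*2.+1)%R.
  apply: eq_big_nat => k /andP[k0 _]; have := ka k k0 => k1.
  rewrite mul2n -subnDA !addn1.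
  by apply: equal_rows_coef => //; rewrite ?mu2' ?mulSn -?doubleMl; lia.
rewrite E_even E_odd; case: ifP => tau0; last first.
  have e : tau = [::] by apply: size0nil; lia.
  rewrite !addr0 [X in (_ + X)%R]big1 ?addr0 // => i _.
  by rewrite /M /merged merged_term_nil // /co mcoeff0.
have pos k : all (leq 1) (a.+1 :: nseq k a) by rewrite /= all_nseq (ltnW Ha) orbT.
have M_even : (\sum_(1 <= k < n.-1./2.+1)
         (skew_coef (sigma ++ [:: a.+1] ++ nseq (n - 2 * k - 1) a
                       ++ [:: k * a; k * a - 1 + t1] ++ tau')
                    (sigmab ++ nseq (n - 2 * k) 1 ++ [:: k * a] ++ taub') c)%N%:Z
     = \sum_(1 <= k < n.-1./2.+1) M k.*2)%R.
  apply: eq_big_nat => k /andP[k0 kn]; have := ka k k0 => k1.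
  have -> : nseq (n - 2 * k) 1 = nseq (size (a.+1 :: nseq (n - 2 * k - 1) a)) 1.
    by congr nseq; rewrite /= size_nseq; lia.
  have -> : [:: k * a] = [:: (k * a - 1).+1] by congr [:: _]; lia.
  apply: merged_coef => //; rewrite ?mu2; [lia..|].
  have -> : n - k.*2 = (n - 2 * k - 1).+1 by lia.
  by rewrite rcons_cons -doubleMl; congr (_ :: rcons _ _); lia.
have M_odd : (\sum_(1 <= k < (n - 2)./2.+1)
         (skew_coef (sigma ++ [:: a.+1] ++ nseq (n - 2 * k - 2) a
                       ++ [:: k.+1 * a - 1; k * a + t1] ++ tau')
                    (sigmab ++ nseq (n - 2 * k - 1) 1 ++ [:: k * a + 1] ++ taub') c)%N%:Z
     = \sum_(1 <= k < (n - 2)./2.+1) M k.*2.+1)%R.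
  apply: eq_big_nat => k /andP[k0 kn]; have := ka k k0 => k1.
  have -> : nseq (n - 2 * k - 1) 1 = nseq (size (a.+1 :: nseq (n - 2 * k - 2) a)) 1.
    by congr nseq; rewrite /= size_nseq; lia.
  rewrite addn1; apply: merged_coef => //; rewrite ?mu2' ?mulSn; [lia..|].
  have -> : n - k.*2.+1 = (n - 2 * k - 2).+1 by lia.
  by rewrite rcons_cons -doubleMl; congr (_ :: rcons _ _); lia.
(* At [i = n] no row stands above [y], so the extra box goes to [y] itself; the parity of [n]
   selects the case. *)
have M_last : ((if odd n then
          (skew_coef (sigma ++ [:: n.+1./2 * a; n.-1./2 * a + t1] ++ tau')
                     (sigmab ++ [:: n.-1./2 * a + 1] ++ taub') c)%N%:Z
        else
          (skew_coef (sigma ++ [:: n./2 * a + 1; n./2 * a - 1 + t1] ++ tau')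
                     (sigmab ++ [:: n./2 * a] ++ taub') c)%N%:Z) = M n)%R.
  have := odd_double_half n; case: ifP => _ en.
    have n1 : n = n.-1./2.*2.+1 by lia.
    have n2 : n.+1./2 = n.-1./2.+1 by lia.
    have := ka n.-1./2; rewrite n2; move: n1; set k := n.-1./2 => n1 k1.
    rewrite addn1; apply: (merged_coef c Hsig Htau Hsb Htb Hsb1 Htb1 Hsbi Htbi Ha (u := [::])) => //; rewrite ?subnn ?n1 ?mu2' ?mulSn -?doubleMl; try lia.
    by rewrite /= ; congr [:: _]; lia.
  have n1 : n = n./2.*2 by rewrite -[LHS]en.
  have := ka n./2; move: n1; set k := n./2 => n1 k1.
  have -> : [:: k * a] = [:: (k * a - 1).+1] by congr [:: _]; lia.
  rewrite addn1; apply: (merged_coef c Hsig Htau Hsb Htb Hsb1 Htb1 Hsbi Htbi Ha (u := [::])) => //;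
    rewrite ?subnn ?n1 ?mu2 -?doubleMl; try lia.
  by rewrite /=; congr [:: _]; lia.
(* With [i = n] split off, the parities are separated on [2..n-1], which explains the shorter ranges
   of the merged families. *)
have M_split : (\sum_(2 <= i < n.+1) M i = \sum_(1 <= k < n.-1./2.+1) M k.*2
    + \sum_(1 <= k < (n - 2)./2.+1) M k.*2.+1 + M n)%R.
  rewrite big_nat_recr //=; congr (_ + _)%R.
  have := @sum_parity _ M n.-1; rewrite prednK // (_ : n.-1.-1 = n - 2); last by lia.
  by apply; lia.
rewrite M_even M_odd M_last M_split !addrA; congr (_ + _ + _)%R.
by rewrite addrAC.
Qed.
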